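(* Let $n\ge 1$ and let $a\le b$ be integers with $a+b=0$ or $a+b=1$. Then the NBC trees of $K_n^{ab}$ are in bijection with the $(1-a,b)$-rooted labelled trees on the vertex set $[n]$.
   Context: Write $[n]=\{1,\dots,n\}$ and, for integers $a\le b$, $[a,b]=\{k\in\mathbb{Z}: a\le k\le b\}$; intervals $[1,m]$ with $m=0$ are empty. Integral gain graphs. An integral gain graph is a graph (no loops, multiple edges allowed) whose edges are labelled invertibly by integers (gains): reversing the direction of an edge negates its gain. The notation $g(i,j)$ means the edge with endpoints $i,j$ having gain $g$ when oriented from $i$ to $j$; thus $g(i,j)=(-g)(j,i)$. $K_n^{ab}$ is the integral gain graph on vertex set $[n]$ whose edges are all $g(i,j)$ with $1\le i<j\le n$ and $g\in[a,b]$. A circle is (the edge set of) a connected 2-regular subgraph (two parallel edges form a circle of length 2); its gain is the sum of the gains of its edges taken in a cyclic direction, and it is balanced if its gain is $0$. A subgraph is balanced if all its circles are balanced. Height functions. A height function on a finite set $V$ of integers is a function $h:V\to\mathbb{N}=\{0,1,2,\dots\}$ with $h^{-1}(0)\ne\emptyset$. An edge $g(i,j)$ is coherent with $h$ if $h(j)-h(i)=g$. For an integral gain graph $\Phi$ on $V$, $\Phi[h]$ is the subgraph on the same vertex set consisting of the edges coherent with $h$. A connected balanced integral gain graph $T$ (for example a tree) has a unique height function $h_T$ on its vertex set with which all its edges are coherent. The order $O_h$ on $V$ is: $i<_{O_h}j$ iff $h(i)>h(j)$, or $h(i)=h(j)$ and $i<j$. It is extended lexicographically to the edges coherent with $h$: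 compare first the $O_h$-smaller endpoints, then the $O_h$-larger endpoints. NBC trees. Given a linear order on edges, a broken circuit is a set of edges obtained from a balanced circle by deleting its smallest edge. An NBC tree of $K_n^{ab}$ is a spanning tree $T$ of $K_n^{ab}$ which, with $h=h_T$, contains no broken circuit of $K_n^{ab}[h]$ with respect to the order $O_h$. Labelled trees. For natural numbers $\alpha,\beta\ge 0$, an $(\alpha,\beta)$-rooted labelled tree with $n$ vertices (or $(\alpha,\beta)$-tree on $[n]$) is a rooted tree with vertex set $[n]$, each of whose edges $(i,j)$, with $i$ the parent and $j$ the child, is weighted with an integer from $[1,\alpha]$ if $i<j$, and from $[1,\beta]$ if $i>j$. *)

(* Defs.v *)
From HB Require Import structures.
From mathcomp Require Import all_boot all_order all_algebra.
From mathcomp Require Import classical_sets functions.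

Set Implicit Arguments.
Unset Strict Implicit.
Unset Printing Implicit Defensive.

Import Order.TTheory GRing.Theory Num.Theory.
Local Open Scope ring_scope.

(* The vertex set [n] = {1, ..., n} is represented by 'I_n, via k |-> k - 1. *)

(* Each edge has a reference orientation, from [src] to [tgt]; parallel edges
   are distinct elements of [edge G]. *)
Record multigraph (V : finType) := Multigraph {
  edge : finType;
  src : edge -> V;
  tgt : edge -> V;
  no_loop : forall e, src e != tgt e }.

(* [gain e] is the gain of e in its reference orientation; the gain in the
   other direction is [- gain e]. *)
Record gain_graph (V : finType) := GainGraph {
  ugraph :> multigraph V;
  gain : edge ugraph -> int }.

(* Subgraphs are on the whole vertex set (except circles, whose vertices are
   those of positive degree), hence are represented by their edge sets. *)
Section Multigraph.
Variables (V : finType) (G : multigraph V).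
Implicit Types (E C : {set edge G}) (e : edge G) (u v : V).

Definition joins e u v : bool :=
  ((src e == u) && (tgt e == v)) || ((src e == v) && (tgt e == u)).

Definition adj E : rel V := fun u v => [exists e in E, joins e u v].

Definition degree E v : nat := #|[set e in E | (src e == v) || (tgt e == v)]|.

Definition is_circle C : bool :=
  [&& C != finset.set0,
      [forall v, (degree C v == 0) || (degree C v == 2)]%N &
      [forall u, forall v, (0 < degree C u)%N ==> (0 < degree C v)%N ==>
         connect (adj C) u v]].

Definition spanning_tree E : bool :=
  [forall u, forall v, connect (adj E) u v] &&
  [forall C : {set edge G}, (C \subset E) ==> ~~ is_circle C].

(* An orientation [o] tells whether e is directed from [src e] to [tgt e]. *)
Definition tail (o : {ffun edge G -> bool}) e : V := if o e then src e else tgt e.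
Definition head (o : {ffun edge G -> bool}) e : V := if o e then tgt e else src e.

(* [o] directs the circle C cyclically: one enters each vertex of C as many
   times (that is, once) as one leaves it. *)
Definition cyclic_direction C (o : {ffun edge G -> bool}) : bool :=
  [forall v, #|[set e in C | head o e == v]| == #|[set e in C | tail o e == v]|].

End Multigraph.

Section GainGraph.
Variables (V : finType) (G : gain_graph V).
Implicit Types (E S B C : {set edge G}) (e : edge G).

Definition circle_gain C (o : {ffun edge G -> bool}) : int :=
  \sum_(e in C) (if o e then gain e else - gain e).

(* The two cyclic directions of a circle yield opposite gains. *)
Definition balanced_circle C : bool :=
  is_circle C &&
  [exists o : {ffun edge G -> bool},
     cyclic_direction C o && (circle_gain C o == 0)].

Definition broken_circuit S (lt : rel (edge G)) B : Prop :=
  exists C e, [/\ C \subset S, balanced_circle C, e \in C,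
    (forall f, f \in C -> f != e -> lt e f) & B = C :\ e].

Definition height_function (h : V -> nat) : Prop := exists v, h v = 0%N.

Definition coherent (h : V -> nat) e : bool :=
  (h (tgt e))%:Z - (h (src e))%:Z == gain e.

Definition coherent_edges (h : V -> nat) : {set edge G} :=
  [set e | coherent h e]%SET.

Definition height_of E (h : V -> nat) : Prop :=
  height_function h /\ forall e, e \in E -> coherent h e.

End GainGraph.

Section HeightOrder.
Variables (n : nat) (G : gain_graph 'I_n) (h : 'I_n -> nat).

Definition Oh (i j : 'I_n) : bool :=
  (h j < h i)%N || ((h i == h j) && (i < j)%N).

Definition Oh_min (e : edge G) : 'I_n :=
  if Oh (src e) (tgt e) then src e else tgt e.

Definition Oh_max (e : edge G) : 'I_n :=
  if Oh (src e) (tgt e) then tgt e else src e.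

Definition Oh_edge : rel (edge G) := fun e f =>
  Oh (Oh_min e) (Oh_min f) ||
  ((Oh_min e == Oh_min f) && Oh (Oh_max e) (Oh_max f)).

End HeightOrder.

(* The height function of a spanning tree T is unique, so that the existential
   quantifier just names h_T. *)
Definition is_nbc_tree (n : nat) (G : gain_graph 'I_n) (T : {set edge G}) : Prop :=
  spanning_tree T /\
  exists h, height_of T h /\
    forall B, broken_circuit (coherent_edges G h) (Oh_edge h) B ->
      ~~ (B \subset T).

Definition zrange (a b : int) : seq int :=
  [seq z <- [seq a + k%:Z | k <- iota 0 `|b - a|.+1] | z <= b].

Lemma mem_zrange (a b z : int) : (z \in zrange a b) = (a <= z <= b).
Proof.
rewrite mem_filter andbC; case: (boolP (z <= b)) => zb; rewrite ?andbF ?andbT //.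
apply/mapP/idP => [[k _ ->]|az]; first by rewrite lerDl.
have z0 : 0 <= z - a by rewrite subr_ge0.
exists `|z - a|%N; last by rewrite gez0_abs // [RHS]addrC subrK.
rewrite mem_iota /= add0n ltnS -lez_nat !gez0_abs ?lerD2r //.
by rewrite subr_ge0 (le_trans az).
Qed.

Section CompleteGraphs.
Variable n : nat.

Definition Kn_edge : finType := {p : 'I_n * 'I_n | (p.1 < p.2)%N}.

Lemma Kn_no_loop (e : Kn_edge) : (val e).1 != (val e).2.
Proof. by rewrite neq_ltn (valP e). Qed.

Definition Kn : multigraph 'I_n :=
  @Multigraph _ Kn_edge (fun e => (val e).1) (fun e => (val e).2) Kn_no_loop.

Variables a b : int.

(* The triple (i, j, g) with i < j and g in [a, b] is the edge g(i, j). *)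
Definition Kab_edge : finType :=
  {t : 'I_n * 'I_n * seq_sub (zrange a b) | (t.1.1 < t.1.2)%N}.

Lemma Kab_no_loop (e : Kab_edge) : (val e).1.1 != (val e).1.2.
Proof. by rewrite neq_ltn (valP e). Qed.

Definition Kab : gain_graph 'I_n :=
  @GainGraph _
    (@Multigraph _ Kab_edge (fun e => (val e).1.1) (fun e => (val e).1.2)
       Kab_no_loop)
    (fun e : Kab_edge => ssval (val e).2).

End CompleteGraphs.

(* [weight e = None] means that the edge e of K_n is absent, and
   [weight e = Some x] that it is present with weight x. *)
Record weighted_rooted_graph (n : nat) := WeightedRootedGraph {
  root : 'I_n;
  weight : {ffun edge (Kn n) -> option int} }.

Section LabelledTrees.
Variables (n : nat) (t : weighted_rooted_graph n).

Definition edges_of : {set edge (Kn n)} := [set e | isSome (weight t e)]%SET.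

(* i is the vertex before j on the simple path from the root to j. *)
Definition parent (i j : 'I_n) : Prop :=
  exists p : seq 'I_n,
    [/\ path (adj edges_of) (root t) (rcons p j),
        uniq (root t :: rcons p j) & last (root t) p = i].

Definition labelled_tree (alpha beta : int) : Prop :=
  spanning_tree edges_of /\
  forall (e : edge (Kn n)) (i j : 'I_n) (x : int),
    weight t e = Some x -> joins e i j -> parent i j ->
    1 <= x <= (if (i < j)%N then alpha else beta).

End LabelledTrees.

Definition nbc_trees (n : nat) (a b : int) : set {set edge (Kab n a b)} :=
  [set T | is_nbc_tree T]%classic.

Definition rooted_labelled_trees (n : nat) (alpha beta : int) :
    set (weighted_rooted_graph n) :=
  [set t | labelled_tree t alpha beta]%classic.

Arguments nbc_trees : clear implicits.
Arguments rooted_labelled_trees : clear implicits.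

(* Main.v *)
(** For a height function h, the coherent edges form a simple graph in which, by
    a + b \in {0, 1}, an edge ik with i <_O j <_O k forces the edge ij. Hence a
    tree T with height h is NBC iff every vertex has at most one O_h-smaller
    neighbour in T: two such neighbours of k close a triangle whose two largest
    edges lie in T, and conversely the O_h-largest vertex of a circle has two
    smaller neighbours through edges that are not the smallest of the circle.
    Rooting T at its O_h-least vertex, parents are exactly smaller neighbours, so
    the gain g of an edge g(i, j), i < j, satisfies g <= 0 iff i is the parent of
    j. The weights 1 - g for g <= 0 and g for g > 0 range over [1, 1 - a] and
    [1, b] respectively; conversely the weights of a labelled tree determine the
    gains, hence the heights, and parents come out O_h-smaller than children. *)

Require Import Defs.
From mathcomp Require Import all_boot all_order all_algebra.
From mathcomp Require Import classical_sets functions.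
From mathcomp Require Import zify.
Import Order.TTheory GRing.Theory Num.Theory.
Local Open Scope ring_scope.

Set Implicit Arguments.
Unset Strict Implicit.
Unset Printing Implicit Defensive.

(** * Circles from cyclic sequences of vertices *)

Lemma next_next_neq (T : eqType) (s : seq T) (x : T) :
  uniq s -> (2 < size s)%N -> x \in s -> next s (next s x) != x.
Proof.
move=> us ss xs; have [i s' def] := rot_to xs.
rewrite -!(next_rot i us); move: us ss.
rewrite -(rot_uniq i) -(size_rot i) def.
case: s' {def} => [|y [|z s']] //= /and3P[xN yN _] _.
rewrite eqxx; move: xN; rewrite !inE !negb_or => /and3P[xy xz _].
by rewrite (eq_sym y) (negPf xy) eqxx eq_sym.
Qed.

Section Multigraphs.
Variables (V : finType) (G : multigraph V).
Implicit Types (E C : {set edge G}) (e : edge G) (u v : V).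

Lemma joinsC e u v : joins e u v = joins e v u.
Proof. exact: orbC. Qed.

Lemma adj_sym E : symmetric (adj E).
Proof. by move=> u v; apply: eq_existsb => e; rewrite joinsC. Qed.

Lemma adj_neq E u v : adj E u v -> u != v.
Proof.
case/existsP=> e /andP[_ /orP[]] /andP[/eqP<- /eqP<-]; last rewrite eq_sym;
  exact: no_loop.
Qed.

Lemma joins_incident e u v w :
  joins e u v -> ((src e == w) || (tgt e == w)) = (w == u) || (w == v).
Proof.
by case/orP=> /andP[/eqP-> /eqP->]; rewrite ![w == _]eq_sym // orbC.
Qed.

(** Choose for each vertex of [s] an edge of [E] to its successor. A vertex then meets exactly the
    edges chosen at itself and at its predecessor, and length above 2 makes these distinct. *)
Lemma cycle_circle E (s : seq V) :
  uniq s -> (2 < size s)%N -> cycle (adj E) s ->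
  exists2 C : {set edge G}, C \subset E & is_circle C.
Proof.
move=> us ss cs.
have [v0 v0s] : exists v, v \in s.
  by case: s ss {us cs} => // v s _; exists v; rewrite mem_head.
(* [e0] is only a default value for the vertices outside [s]. *)
have [e0 _] := existsP (next_cycle cs v0s).
have [ed edP] : exists ed : V -> edge G, forall v,
    v \in s -> (ed v \in E) && joins (ed v) v (next s v).
  apply: (fin_all_exists (P := fun v e =>
    v \in s -> (e \in E) && joins e v (next s v))) => v.
  have [vs|vs] := boolP (v \in s); last by exists e0.
  by have /existsP[e ?] := next_cycle cs vs; exists e.
have inc v w : v \in s -> ((src (ed v) == w) || (tgt (ed v) == w)) =
    (w == v) || (w == next s v).
  by move=> /edP/andP[_]; apply: joins_incident.
pose C := (ed @: s)%SET.
have degin v : v \in s -> degree C v = 2.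
  move=> vs; have ps : prev s v \in s by rewrite mem_prev.
  rewrite /degree (_ : [set e in C | _]%SET = [set ed v; ed (prev s v)]%SET).
    (* If the two edges coincided, the successor of [v] would be its predecessor or [v] itself. *)
    rewrite cards2; case: eqVneq => // eqe.
    have := inc (prev s v) (next s v) ps; rewrite -eqe inc // eqxx orbT.
    rewrite next_prev // => /esym/orP[] /eqP nv.
      by have := next_next_neq us ss ps; rewrite next_prev // nv eqxx.
    have := next_cycle cs vs; rewrite nv => /adj_neq.
    by rewrite eqxx.
  apply/setP=> e; rewrite !inE; apply/andP/orP.
    case=> /imsetP[x xs ->]; rewrite inc // => /orP[] /eqP->; [left|right] => //.
    by rewrite prev_next.
  by case=> /eqP->; (split; first exact: imset_f); rewrite inc ?next_prev ?eqxx ?orbT.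
have degout v : v \notin s -> degree C v = 0.
  move=> vs; apply: eq_card0 => e; rewrite !inE; apply/negP.
  case/andP=> /imsetP[x xs ->]; rewrite inc // => /orP[] /eqP vE;
  by move: vs; rewrite vE ?mem_next xs.
have inC v : (0 < degree C v)%N -> v \in s.
  by apply: contraTT => /degout->.
exists C.
  by apply/fintype.subsetP=> e /imsetP[x /edP/andP[? _] ->].
apply/and3P; split.
- by apply/set0Pn; exists (ed v0); apply: imset_f.
- by apply/forallP=> v; case: (boolP (v \in s)) => [/degin|/degout] ->.
- apply/forallP=> u; apply/forallP=> v; apply/implyP=> /inC us'.
  apply/implyP=> /inC vs'; apply: (@connect_cycle _ _ s) => //.
  apply: cycle_from_next => // x xs; apply/existsP; exists (ed x).
  by have /andP[_ ->] := edP _ xs; rewrite imset_f.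
Qed.

End Multigraphs.

(** * Transport along edge maps that preserve endpoints *)

Section Transfer.
Variables (V : finType) (G H : multigraph V) (phi : edge G -> edge H).
Hypotheses (src_phi : forall e, src (phi e) = src e)
           (tgt_phi : forall e, tgt (phi e) = tgt e).
Implicit Types (E C : {set edge G}).

Lemma adj_imset E : adj (phi @: E)%SET =2 adj E.
Proof.
move=> u v; apply/existsP/existsP => [[_ /andP[/imsetP[e eE ->]]]|[e /andP[eE j]]].
  by rewrite /joins src_phi tgt_phi => j; exists e; apply/andP.
exists (phi e); rewrite imset_f //= /joins src_phi tgt_phi //.
Qed.

Lemma degree_imset C v :
  {in C &, injective phi} -> degree (phi @: C)%SET v = degree C v.
Proof.
move=> inj; rewrite /degree.
rewrite -[RHS](card_in_imset (f := phi)); last first.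
  by move=> e f; rewrite !inE => /andP[eC _] /andP[fC _]; apply: inj.
apply: eq_card => e; rewrite !inE; apply/andP/imsetP.
  case=> /imsetP[f fC ->]; rewrite src_phi tgt_phi => inc.
  by exists f; rewrite // inE fC.
case=> f; rewrite inE => /andP[fC inc] ->.
by rewrite src_phi tgt_phi imset_f.
Qed.

Lemma circle_imset C :
  {in C &, injective phi} -> is_circle (phi @: C)%SET = is_circle C.
Proof.
move=> inj; rewrite /is_circle imset_eq0; congr [&& _, _ & _].
  by apply: eq_forallb => v; rewrite degree_imset.
apply: eq_forallb => u; apply: eq_forallb => v; rewrite !degree_imset //.
by rewrite (eq_connect (adj_imset C)).
Qed.

(** An edge set inside the image is the image of its preimage in [E], so circles correspond both
    ways. The intended map forgets gains; it is injective on coherent edges but not in general. *)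
Lemma spanning_tree_imset E :
  {in E &, injective phi} -> spanning_tree (phi @: E)%SET = spanning_tree E.
Proof.
move=> inj; rewrite /spanning_tree; congr (_ && _).
  apply: eq_forallb => u; apply: eq_forallb => v.
  by rewrite (eq_connect (adj_imset E)).
apply/forallP/forallP => acy C; apply/implyP=> CE.
  rewrite -circle_imset; first by apply: (implyP (acy _)); apply: imsetS.
  by move=> e f eC fC; apply: inj; apply: (fintype.subsetP CE).
have [D DE ->] : exists2 D : {set edge G}, D \subset E & C = (phi @: D)%SET.
  exists [set e in E | phi e \in C]%SET.
    by apply/fintype.subsetP=> e; rewrite inE => /andP[].
  apply/setP=> e; apply/idP/imsetP=> [eC|[f]]; last first.
    by rewrite inE => /andP[_ fC] ->.
  by have /imsetP[f fE def] := fintype.subsetP CE _ eC; exists f; rewrite // inE fE -def.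
rewrite circle_imset; first exact: (implyP (acy D)).
by move=> e f eC fC; apply: inj; apply: (fintype.subsetP DE).
Qed.

End Transfer.

(** * Parents in a rooted tree *)

Section RootedTree.
Variables (V : finType) (G : multigraph V) (E : {set edge G}) (r : V).

(** Generalizes [parent] to any multigraph, so that it applies before and after gains are forgotten;
    on [Kn] the two are convertible. *)
Definition tree_parent (u v : V) : Prop :=
  exists p : seq V,
    [/\ path (adj E) r (rcons p v), uniq (r :: rcons p v) & last r p = u].

(* Along a simple path from the root, a first descent v > w would give v two
   smaller neighbours. *)
Lemma tree_parent_lt (lt : rel V) :
  (forall v, adj E r v -> lt r v) ->
  (forall u v, adj E u v -> lt u v || lt v u) ->
  (forall u w v, adj E u v -> adj E w v -> lt u v -> lt w v -> u = w) ->
  forall u v, tree_parent u v -> lt u v.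
Proof.
move=> ltr tot smaller u v [p [ep up <-]] {u}.
elim/last_ind: p v ep up => [|p w IHp] v.
  by move=> /= /andP[/ltr].
rewrite last_rcons rcons_path last_rcons -rcons_cons rcons_uniq.
case/andP=> ep wv /andP[vp up].
have lw := IHp w ep up; have /orP[//|vw] := tot _ _ wv.
move: ep; rewrite rcons_path => /andP[_ aw].
have eqv := smaller _ _ _ aw (etrans (adj_sym _ _ _) wv) lw vw.
by rewrite -eqv -rcons_cons mem_rcons inE mem_last orbT in vp.
Qed.

Hypothesis connE : forall u v, connect (adj E) u v.

Lemma simple_path v :
  exists p, [/\ path (adj E) r p, uniq (r :: p) & last r p = v].
Proof.
have /connectP[p ep ->] := connE r v.
by have [q eq uq _] := shortenP ep; exists q.
Qed.

Lemma tree_parent_exists v : v != r -> exists u, tree_parent u v.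
Proof.
have [p [ep up <-]] := simple_path v.
case/lastP: p ep up => [|p w] ep up; first by rewrite eqxx.
by rewrite last_rcons => _; exists (last r p), p.
Qed.

(** Take a simple path from the root to [u]. If it avoids [v], append [v]; otherwise cut it at [v]
    and append [u]. *)
Lemma adj_tree_parent u v :
  adj E u v -> tree_parent u v \/ tree_parent v u.
Proof.
move=> uv; have [p [ep up lp]] := simple_path u.
have [vp|vp] := boolP (v \in r :: p); last first.
  left; exists p; split=> //; first by rewrite rcons_path ep lp.
  by rewrite -rcons_cons rcons_uniq vp.
right; have [q [s [defp lq]]] : exists q s, p = q ++ s /\ last r q = v.
  by case/splitPl: vp => q s lq; exists q, s.
exists q; split=> //.
  rewrite rcons_path lq adj_sym uv andbT.
  by move: ep; rewrite defp cat_path => /andP[].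
rewrite -rcons_cons rcons_uniq; move: up lp; rewrite defp -cat_cons cat_uniq.
case/and3P=> -> /hasPn nqs _; rewrite last_cat lq andbT => lu.
case/lastP: s {defp} nqs lu => [|s x] nqs /=.
  by move=> vu; move: (adj_neq uv); rewrite vu eqxx.
by rewrite last_rcons => <-; apply: nqs; rewrite mem_rcons mem_head.
Qed.

Hypothesis acyclicE : forall C : {set edge G}, C \subset E -> ~~ is_circle C.

(** Distinct parents [u] and [w] of [v] are connected through the root in the graph with [v]
    deleted, whose adjacency is [e]. A simple path between them closes up through [v] to a
    circle. *)
Lemma tree_parent_unique u w v : tree_parent u v -> tree_parent w v -> u = w.
Proof.
move=> [p [ep up lp]] [q [eq uq lq]]; apply/eqP; apply/negPn/negP => uw.
pose e x y := [&& adj E x y, x != v & y != v].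
have esym : connect_sym e.
  by apply: sym_connect_sym => x y; rewrite /e adj_sym [(_ != v) && _]andbC.
have restr s : path (adj E) r (rcons s v) -> uniq (r :: rcons s v) ->
    connect e r (last r s) /\ adj E (last r s) v.
  rewrite rcons_path -rcons_cons rcons_uniq => /andP[es ->] /andP[vs _].
  split=> //; apply/connectP; exists s => //.
  elim: s r es vs => //= y s IHs x /andP[xy es].
  rewrite !inE !negb_or => /and3P[vx vy vs].
  by rewrite {1}/e xy ![_ == v]eq_sym vx vy IHs // inE negb_or vy.
have [ru uv] := restr p ep up; have [rw wv] := restr q eq uq.
rewrite lp in ru uv; rewrite lq in rw wv.
have : connect e u w by rewrite (connect_trans _ rw) // esym.
case/connectP=> s0 es0 ws; case/shortenP: es0 ws => s es us _ ws {s0}.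
have [C CE] : exists2 C : {set edge G}, C \subset E & is_circle C.
  apply: (@cycle_circle _ _ E (v :: u :: s)).
  - rewrite cons_uniq us andbT.
    have nu := adj_neq uv.
    elim: s u es nu {us ws ru uv uw lp} => [|y s IHs] x /=.
      by rewrite inE eq_sym.
    by case/andP=> /and3P[_ _ yv] /IHs/(_ yv) ns xv; rewrite inE eq_sym negb_or xv.
  - by case: s ws {es us} => //= wu; rewrite wu eqxx in uw.
  - rewrite /= adj_sym uv rcons_path -ws wv andbT /=.
    by apply: sub_path es => x y /and3P[].
by rewrite (negPf (acyclicE CE)).
Qed.

(** Peel off the common last vertex: the two vertices before it are both its parents, hence
    equal. *)
Lemma simple_path_unique p q :
  path (adj E) r p -> uniq (r :: p) -> path (adj E) r q -> uniq (r :: q) ->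
  last r p = last r q -> p = q.
Proof.
elim/last_ind: p q => [|p v IHp] q ep up eq uq.
  case/lastP: q eq uq => // q w _; rewrite last_rcons /= => /andP[rN _] rw.
  by rewrite -rw mem_rcons mem_head in rN.
case/lastP: q eq uq => [|q w] eq uq; rewrite !last_rcons.
  by move=> rv; move: up; rewrite rv /= mem_rcons mem_head.
move=> vw; subst w; congr (rcons _ _).
have sub s : path (adj E) r (rcons s v) -> uniq (r :: rcons s v) ->
    path (adj E) r s /\ uniq (r :: s).
  by rewrite rcons_path -rcons_cons rcons_uniq => /andP[-> _] /andP[].
have [ep' up'] := sub _ ep up; have [eq' uq'] := sub _ eq uq.
by apply: IHp => //; apply: (@tree_parent_unique _ _ v); [exists p|exists q].
Qed.

(** Integrates prescribed increments along the tree: [d v] is the sum of [c] over the simple path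
    from the root to [v], root excluded. *)
Lemma tree_potential (c : V -> nat) :
  exists d : V -> nat, forall u v, tree_parent u v -> d v = (d u + c v)%N.
Proof.
have [p pP] := fin_all_exists simple_path.
exists (fun v => \sum_(w <- p v) c w)%N => u v [q [eq uq lq]].
have [eu uu lu] := pP u; have [ev uv lv] := pP v.
have -> : p v = rcons q v.
  by apply: simple_path_unique => //; rewrite last_rcons.
suff -> : p u = q by rewrite big_rcons.
move: eq uq; rewrite rcons_path -rcons_cons rcons_uniq => /andP[eq _] /andP[_ uq].
by apply: simple_path_unique; rewrite ?lu ?lq.
Qed.

End RootedTree.

(** * Balanced circles and triangles *)

Lemma card_set3_pred (T : finType) (x y z : T) (P : pred T) :
  x != y -> x != z -> y != z ->
  #|[set e in [set x; y; z] | P e]%SET| = (P x + P y + P z)%N.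
Proof.
move=> xy xz yz; rewrite -sum1_card.
under eq_bigl do rewrite inE.
rewrite big_mkcondr /= finset.setUC big_setU1 ?inE ?negb_or; last first.
  by rewrite !(eq_sym z) xz.
rewrite big_setU1 ?inE // big_set1 /=.
by do 3!case: (P _).
Qed.

Section Circles.
Variables (V : finType) (G : gain_graph V).
Implicit Types (C : {set edge G}) (e f : edge G) (h : V -> nat).

Lemma degree_incident C e v :
  e \in C -> (src e == v) || (tgt e == v) -> (0 < degree C v)%N.
Proof. by move=> eC inc; apply/card_gt0P; exists e; rewrite inE eC. Qed.

Lemma incident_joins e v :
  (src e == v) || (tgt e == v) -> exists2 w, joins e w v & w != v.
Proof.
have nl := no_loop e.
case/orP=> /eqP<-; [exists (tgt e)|exists (src e)] => //;
  rewrite /joins ?eqxx ?orbT //; by rewrite eq_sym.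
Qed.

(** Gains are height differences, so the sum around [C] cancels: grouped by vertex, each height is
    added once per entering edge and subtracted once per leaving edge. *)
Lemma coherent_circle_balanced h C (o : {ffun edge G -> bool}) :
  C \subset coherent_edges G h -> is_circle C -> cyclic_direction C o ->
  balanced_circle C.
Proof.
move=> coh circ cyc; rewrite /balanced_circle circ /=.
apply/existsP; exists o; rewrite cyc /=; apply/eqP.
have sumE (k : edge G -> V) : \sum_(e in C) (h (k e))%:Z =
    \sum_v (h v)%:Z *+ #|[set e in C | k e == v]%SET|.
  rewrite (partition_big k predT) //=; apply: eq_bigr => v _.
  rewrite -sumr_const; under [RHS]eq_bigl do rewrite inE.
  by apply: eq_bigr => e /andP[_ /eqP->].
transitivity (\sum_(e in C) ((h (Defs.head o e))%:Z - (h (tail o e))%:Z)).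
  apply: eq_bigr => e eC; have := fintype.subsetP coh _ eC.
  rewrite inE /coherent /Defs.head /tail => /eqP<-.
  by case: (o e); rewrite // opprB.
rewrite sumrB !sumE; apply/eqP; rewrite subr_eq0; apply/eqP.
by apply: eq_bigr => v _; have /forallP/(_ v)/eqP-> := cyc.
Qed.

Lemma triangle_balanced_circle h e0 e1 e2 x y z :
  x != y -> y != z -> x != z ->
  joins e0 x y -> joins e1 y z -> joins e2 z x ->
  [set e0; e1; e2]%SET \subset coherent_edges G h ->
  balanced_circle [set e0; e1; e2]%SET.
Proof.
move=> xy yz xz j0 j1 j2 coh.
have i0 := joins_incident _ j0; have i1 := joins_incident _ j1.
have i2 := joins_incident _ j2.
have e01 : e0 != e1.
  by apply/eqP=> e; have := i0 z; rewrite e i1 !(eq_sym z) eqxx orbT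
    (negPf xz) (negPf yz).
have e02 : e0 != e2.
  by apply/eqP=> e; have := i0 z; rewrite e i2 !(eq_sym z) eqxx
    (negPf xz) (negPf yz).
have e12 : e1 != e2.
  by apply/eqP=> e; have := i1 x; rewrite e i2 eqxx orbT
    (negPf xz) (negPf xy).
have degE v : degree [set e0; e1; e2]%SET v =
    ((v == x) + (v == y) + (v == z)).*2%N.
  rewrite /degree card_set3_pred // i0 i1 i2.
  case: (eqVneq v x) => [->|_]; first by rewrite (negPf xy) (negPf xz).
  by case: (eqVneq v y) => [->|_]; rewrite ?(negPf yz) //; case: (v == z).
(* The direction from [x] to [y] to [z] and back to [x]. *)
pose o := [ffun e : edge G => if e == e0 then src e == x else
             if e == e1 then src e == y else src e == z].
apply: (coherent_circle_balanced (o := o) coh).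
  apply/and3P; split.
  - by apply/set0Pn; exists e0; rewrite !inE eqxx.
  - apply/forallP=> v; rewrite degE.
    case: (eqVneq v x) => [->|_]; first by rewrite (negPf xy) (negPf xz).
    by case: (eqVneq v y) => [->|_]; rewrite ?(negPf yz) //; case: (v == z).
  - have a0 : adj [set e0; e1; e2]%SET x y.
      by apply/existsP; exists e0; rewrite j0 !inE eqxx.
    have a1 : adj [set e0; e1; e2]%SET y z.
      by apply/existsP; exists e1; rewrite j1 !inE eqxx orbT.
    have a2 : adj [set e0; e1; e2]%SET z x.
      by apply/existsP; exists e2; rewrite j2 !inE eqxx orbT.
    have mem v : (0 < degree [set e0; e1; e2]%SET v)%N -> v \in [:: x; y; z].
      by rewrite degE !inE; do 3!case: eqP.
    apply/forallP=> u; apply/forallP=> v; apply/implyP=> /mem us.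
    apply/implyP=> /mem vs; apply: connect_cycle us vs => /=.
    by rewrite a0 a1 a2.
apply/forallP=> v; rewrite !card_set3_pred // /Defs.head /tail !ffunE.
rewrite !eqxx ![_ == e0]eq_sym [e2 == e1]eq_sym (negPf e01) (negPf e02) (negPf e12).
have dirE e p q : p != q -> joins e p q ->
    (if src e == p then tgt e else src e) = q /\
    (if src e == p then src e else tgt e) = p.
  move=> pq /orP[] /andP[/eqP-> /eqP->]; first by rewrite eqxx.
  by rewrite eq_sym (negPf pq).
have zx : z != x by rewrite eq_sym.
have [-> ->] := dirE _ _ _ xy j0; have [-> ->] := dirE _ _ _ yz j1.
have [-> ->] := dirE _ _ _ zx j2.
by apply/eqP; rewrite addnC addnA.
Qed.

End Circles.

(** * The strict total order O_h *)

Section HeightOrderTheory.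
Variables (n : nat) (h : 'I_n -> nat).
Implicit Types (i j k : 'I_n).

Lemma Oh_irr i : Oh h i i = false.
Proof. by rewrite /Oh !ltnn andbF. Qed.

Lemma Oh_trans : transitive (Oh h).
Proof. by move=> j i k; rewrite /Oh; lia. Qed.

Lemma Oh_asym i j : Oh h i j -> Oh h j i = false.
Proof. by rewrite /Oh; lia. Qed.

Lemma Oh_total i j : i != j -> Oh h i j || Oh h j i.
Proof. by rewrite -val_eqE /Oh /=; lia. Qed.

(** Maximize the number of O_h-smaller vertices: any larger [j] would have strictly more, since it
    also counts [i]. *)
Lemma Oh_greatest (P : pred 'I_n) i0 : P i0 ->
  exists2 i, P i & forall j, P j -> j != i -> Oh h j i.
Proof.
move=> Pi0; case: (arg_maxnP (fun i => #|[pred k | Oh h k i]|) Pi0) => i Pi imax.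
exists i => // j Pj ji; have /orP[//|ij] := Oh_total ji.
have := imax j Pj; rewrite /= leqNgt proper_card //.
apply/properP; split; first by apply/fintype.subsetP=> k; rewrite !inE => /Oh_trans ->.
by exists i; rewrite !inE ?Oh_irr.
Qed.

Lemma Oh_least (P : pred 'I_n) i0 : P i0 ->
  exists2 i, P i & forall j, P j -> j != i -> Oh h i j.
Proof.
move=> Pi0; case: (arg_maxnP (fun i => #|[pred k | Oh h i k]|) Pi0) => i Pi imax.
exists i => // j Pj ji; have /orP[ij|//] := Oh_total ji.
have := imax j Pj; rewrite /= leqNgt proper_card //.
apply/properP; split; first by apply/fintype.subsetP=> k; rewrite !inE; apply: Oh_trans.
by exists i; rewrite !inE ?Oh_irr.
Qed.

Variable G : gain_graph 'I_n.

Lemma Oh_min_max (e : edge G) i j :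
  joins e i j -> Oh h i j -> Oh_min h e = i /\ Oh_max h e = j.
Proof.
by rewrite /Oh_min /Oh_max => /orP[] /andP[/eqP-> /eqP->] ij; rewrite ?ij ?(Oh_asym ij).
Qed.

Lemma Oh_min_incident (e : edge G) :
  (src e == Oh_min h e) || (tgt e == Oh_min h e).
Proof. by rewrite /Oh_min; case: ifP; rewrite eqxx ?orbT. Qed.

End HeightOrderTheory.

(** * Unique smaller neighbours exclude broken circuits *)

Definition smaller_unique n (h : 'I_n -> nat) (e : rel 'I_n) :=
  forall u w v, e u v -> e w v -> Oh h u v -> Oh h w v -> u = w.

(** With the rest of the circle in [T], its smallest edge [e] must join the least vertex [y] to the
    greatest vertex [x]. But then the other edge at [y] is not larger than [e]. *)
Lemma smaller_unique_nbc n (G : gain_graph 'I_n) h (T B : {set edge G}) :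
  {in coherent_edges G h &, forall e f u v, joins e u v -> joins f u v -> e = f} ->
  smaller_unique h (adj T) ->
  broken_circuit (coherent_edges G h) (Oh_edge h) B -> ~~ (B \subset T).
Proof.
move=> simple uniqT [C [e [coh /andP[circ _] eC emin ->]]]; apply/negP=> CT.
have /and3P[_ /forallP deg2 _] := circ.
have simp f g u v : f \in C -> g \in C -> joins f u v -> joins g u v -> f = g.
  by move=> /(fintype.subsetP coh) fC /(fintype.subsetP coh) gC; apply: (simple f g fC gC).
have dsrc : (0 < degree C (src e))%N by apply: degree_incident eC _; rewrite eqxx.
have pair v : (0 < degree C v)%N -> exists f g, [/\ f != g, f \in C, g \in C &
    forall k, k \in C -> ((src k == v) || (tgt k == v)) = (k \in [:: f; g])].
  move=> dv; have := deg2 v; rewrite eqn0Ngt dv /= => /cards2P[f [g [fg E]]].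
  have mem k : (k \in C) && ((src k == v) || (tgt k == v)) = (k \in [:: f; g]).
    by have := congr1 (fun A : {set edge G} => k \in A) E; rewrite !inE.
  exists f, g; split=> //; last by move=> k kC; rewrite -mem kC.
    by have := mem f; rewrite mem_head => /andP[].
  by have := mem g; rewrite !inE eqxx orbT => /andP[].
have [x dx xmax] := Oh_greatest h (P := fun v => 0 < degree C v)%N (src e) dsrc.
have [y dy ymin] := Oh_least h (P := fun v => 0 < degree C v)%N (src e) dsrc.
have nbr k v : k \in C -> (src k == v) || (tgt k == v) ->
    exists w, [/\ joins k w v, w != v & (0 < degree C w)%N].
  move=> kC /incident_joins[w j wv]; exists w; split=> //.
  by apply: (degree_incident kC); rewrite (joins_incident _ j) eqxx.
(* Otherwise both edges of [C] at [x] lie in [T], and by simplicity they lead to two different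
   smaller neighbours of [x]. *)
have xe : (src e == x) || (tgt e == x).
  have [f [g [fg fC gC inc]]] := pair x dx; rewrite inc //; apply/negPn/negP.
  rewrite !inE negb_or => /andP[ef eg].
  have [|u [ju ux du]] := nbr f x fC; first by rewrite inc ?mem_head.
  have [|w [jw wx dw]] := nbr g x gC; first by rewrite inc // !inE eqxx orbT.
  have inT k z : k \in C -> e != k -> joins k z x -> adj T z x.
    move=> kC ek jk; apply/existsP; exists k; rewrite jk andbT.
    by apply: (fintype.subsetP CT); rewrite !inE eq_sym ek.
  have uw := uniqT _ _ _ (inT _ _ fC ef ju) (inT _ _ gC eg jw) (xmax _ du ux)
    (xmax _ dw wx).
  by move/eqP: fg; apply; apply: simp ju _; rewrite // uw.
(* An edge of [C] at [y] has [y] as smaller endpoint, which is compared first; so the smallest edge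
   also starts at [y]. *)
have ye : (src e == y) || (tgt e == y).
  have [f [g [fg fC gC inc]]] := pair y dy.
  have [->|fe] := eqVneq e f; first by rewrite inc ?mem_head.
  have [|u [ju uy du]] := nbr f y fC; first by rewrite inc ?mem_head.
  have [fmin _] := Oh_min_max (etrans (joinsC _ _ _) ju) (ymin _ du uy).
  have dm : (0 < degree C (Oh_min h e))%N.
    by apply: (degree_incident eC); apply: Oh_min_incident.
  have fe' : f != e by rewrite eq_sym.
  have /orP[|/andP[/eqP eqm _]] := emin f fC fe'.
    rewrite fmin; have [->|my] := eqVneq (Oh_min h e) y; first by rewrite Oh_irr.
    by rewrite (Oh_asym (ymin _ dm my)).
  by rewrite -fmin -eqm Oh_min_incident.
have [w [jw wx dw]] := nbr e x eC xe.
have xy : x != y.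
  apply/eqP=> xy; have := xmax _ dw wx.
  by rewrite xy (Oh_asym (ymin _ dw _)) // -xy.
have je : joins e y x.
  have := joins_incident y jw; rewrite ye => /esym/orP[]/eqP yE.
    by rewrite yE.
  by rewrite yE eqxx in xy.
have [emi ema] := Oh_min_max je (ymin _ dx xy).
have [g gC [ge yg]] : exists2 g, g \in C & g != e /\ (src g == y) || (tgt g == y).
  have [f [g [fg fC gC inc]]] := pair y dy.
  have := inc e eC; rewrite ye !inE => /esym/orP[]/eqP E.
    by exists g => //; rewrite inc // !inE eqxx orbT E eq_sym.
  by exists f => //; rewrite inc // mem_head E.
have [u [ju uy du]] := nbr g y gC yg.
have [gmi gma] := Oh_min_max (etrans (joinsC _ _ _) ju) (ymin _ du uy).
(* Both edges start at [y], so [x] would have to precede the larger endpoint [u] of [g], although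
   [x] is greatest. *)
have := emin g gC ge; rewrite /Oh_edge emi ema gmi gma Oh_irr eqxx /=.
have [ux|ux] := eqVneq u x; last by rewrite (Oh_asym (xmax _ du ux)).
by rewrite -ux Oh_irr.
Qed.

(** * Coherent edges of [Kab], and why NBC trees have unique smaller neighbours *)

Section CompleteGainGraph.
Variables (n : nat) (a b : int).
Local Notation K := (Kab n a b).
Implicit Types (e f : edge K) (T : {set edge K}) (h : 'I_n -> nat) (i j : 'I_n).

Lemma gain_bounds e : a <= gain e <= b.
Proof. by rewrite -mem_zrange; apply: ssvalP. Qed.

Lemma Kab_edge_exists i j (g : int) : (i < j)%N -> a <= g <= b ->
  exists e, [/\ src e = i, tgt e = j & gain e = g].
Proof.
rewrite -mem_zrange => ij gab.
by exists (exist (fun t : 'I_n * 'I_n * seq_sub (zrange a b) => (t.1.1 < t.1.2)%N)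
  (i, j, SeqSub gab) ij).
Qed.

Lemma Kab_edge_eq e f : src e = src f -> tgt e = tgt f -> gain e = gain f -> e = f.
Proof.
case: e f => [[[i j] g] ij] [[[k l] g'] kl] /= ik jl gg; apply: val_inj => /=.
by rewrite ik jl; congr (_, _); apply: val_inj.
Qed.

Lemma Kab_src_lt_tgt e : (src e < tgt e)%N.
Proof. exact: valP e. Qed.

Lemma joins_endpoints e i j :
  (i < j)%N -> joins e i j = (src e == i) && (tgt e == j).
Proof.
move=> ij; rewrite /joins orbC; case: andP => // -[/eqP ej /eqP ei].
by have := Kab_src_lt_tgt e; rewrite ej ei ltnNge (ltnW ij).
Qed.

(** Parallel edges differ in gain, while the heights of the endpoints prescribe the gain. *)
Lemma coherent_simple h :
  {in coherent_edges K h &, forall e f i j, joins e i j -> joins f i j -> e = f}.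
Proof.
have key e f i j : e \in coherent_edges K h -> f \in coherent_edges K h ->
    (i < j)%N -> joins e i j -> joins f i j -> e = f.
  rewrite !inE /coherent => /eqP ge /eqP gf ij; rewrite !joins_endpoints //.
  move=> /andP[/eqP se /eqP te] /andP[/eqP sf /eqP tf].
  by apply: Kab_edge_eq; rewrite ?se ?te // -ge -gf se te sf tf.
move=> e f eh fh i j je jf; have [ij|ji|/val_inj eqij] := ltngtP i j.
- exact: key je jf.
- by apply: (key e f j i); rewrite // joinsC.
have ij : adj [set e]%SET i j by apply/existsP; exists e; rewrite inE eqxx.
by move: (adj_neq ij); rewrite eqij eqxx.
Qed.

(** The gain, in reference orientation, of a coherent edge between [i] and [j]. It is symmetric in
    [i] and [j], so the labels need not be sorted first. *)
Definition gap h i j : int :=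
  if (i < j)%N then (h j)%:Z - (h i)%:Z else (h i)%:Z - (h j)%:Z.

Lemma coherent_gap h e i j :
  coherent h e -> joins e i j -> gain e = gap h i j.
Proof.
move=> /eqP <- je; rewrite /gap; case: ltngtP => [ij|ji|/val_inj eqij].
- by move: je; rewrite joins_endpoints // => /andP[/eqP-> /eqP->].
- by move: je; rewrite joinsC joins_endpoints // => /andP[/eqP-> /eqP->].
have ij : adj [set e]%SET i j by apply/existsP; exists e; rewrite inE eqxx.
by move: (adj_neq ij); rewrite eqij eqxx.
Qed.

Lemma coherent_edge_exists h i j : i != j -> a <= gap h i j <= b ->
  exists2 e, e \in coherent_edges K h & joins e i j.
Proof.
rewrite /gap -val_eqE /=; case: ltngtP => // [ij|ji] _ gab.
  have [e [se te ge]] := Kab_edge_exists ij gab; exists e.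
    by rewrite inE /coherent se te ge.
  by rewrite joins_endpoints // se te !eqxx.
have [e [se te ge]] := Kab_edge_exists ji gab; exists e.
  by rewrite inE /coherent se te ge.
by rewrite joinsC joins_endpoints // se te !eqxx.
Qed.

Hypothesis hsum : a + b = 0 \/ a + b = 1.

(** Heights weakly decrease along [i], [j], [k], so the drop from [i] to [j] is at most that from
    [i] to [k]. Drops are bounded by [- a] towards a larger label and by [b] towards a smaller one,
    and [- a] is [b] or [b - 1]. The bound can tighten only when [k < i < j]; then [h j > h k], and
    the drop shrinks by at least 1. *)
Lemma gap_between h i j k : Oh h i j -> Oh h j k ->
  a <= gap h i k <= b -> a <= gap h i j <= b.
Proof.
by move: hsum; rewrite /gap /Oh => -[] s; do 2!case: (ltnP i) => ?; lia.
Qed.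

Lemma nbc_smaller_unique h T : T \subset coherent_edges K h ->
  (forall B, broken_circuit (coherent_edges K h) (Oh_edge h) B -> ~~ (B \subset T)) ->
  smaller_unique h (adj T).
Proof.
move=> coh nbc.
suff key u w v : adj T u v -> adj T w v -> Oh h u w -> Oh h w v -> False.
  move=> u w v uv wv hu hw; apply/eqP/negPn/negP => uw.
  have /orP[h'|h'] := Oh_total h uw; first exact: (key u w v).
  exact: (key w u v).
move=> uv wv uw hwv; have huv := Oh_trans uw hwv.
have nuv := adj_neq uv; have nwv := adj_neq wv.
have nuw : u != w by apply: contraTneq uw => ->; rewrite Oh_irr.
case/existsP: uv => e2 /andP[e2T j2]; case/existsP: wv => e1 /andP[e1T j1].
have e2h := fintype.subsetP coh _ e2T; have e1h := fintype.subsetP coh _ e1T.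
(* The third side of the triangle, provided by the bounds on the gain of [e2]. *)
have [e0 e0h j0] : exists2 e, e \in coherent_edges K h & joins e u w.
  apply: coherent_edge_exists => //; apply: gap_between uw hwv _.
  by rewrite inE in e2h; rewrite -(coherent_gap e2h j2) gain_bounds.
have j2' : joins e2 v u by rewrite joinsC.
have Ch : [set e0; e1; e2]%SET \subset coherent_edges K h.
  by apply/fintype.subsetP=> e; rewrite !finset.in_setU !finset.in_set1 => /orP[/orP[]|] /eqP->.
have bal := triangle_balanced_circle nuw nwv nuv j0 j1 j2' Ch.
have [m0 M0] := Oh_min_max j0 uw.
have [m1 M1] := Oh_min_max j1 hwv.
have [m2 M2] := Oh_min_max j2 huv.
(* [e0] is the smallest side: [e1] starts at [w], after [u], and [e2] starts at [u] but ends at [v],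
   after [w]. *)
have /nbc/negP[] : broken_circuit (coherent_edges K h) (Oh_edge h)
    ([set e0; e1; e2]%SET :\ e0)%SET.
  exists [set e0; e1; e2]%SET, e0; split=> //; first by rewrite !inE eqxx.
  move=> f; rewrite !inE => /orP[/orP[]|] /eqP-> ne.
  - by rewrite eqxx in ne.
  - by rewrite /Oh_edge m0 m1 uw.
  - by rewrite /Oh_edge m0 m2 M0 M2 eqxx hwv orbT.
apply/fintype.subsetP=> f; rewrite !inE => /andP[/negPf ->] /orP[/orP[]|] //.
  by move=> /eqP->.
by move=> /eqP->.
Qed.

End CompleteGainGraph.

(** * The correspondence between NBC trees and labelled trees *)

Lemma tree_parent_adj (V : finType) (G : multigraph V) (E : {set edge G}) r u v :
  tree_parent E r u v -> adj E u v.
Proof. by case=> p [ep _ <-]; move: ep; rewrite rcons_path => /andP[]. Qed.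

Lemma tree_parent_root (V : finType) (G : multigraph V) (E : {set edge G}) r u :
  ~ tree_parent E r u r.
Proof. by case=> p [_ /andP[rN _] _]; rewrite mem_rcons mem_head in rN. Qed.

Lemma eq_tree_parent (V : finType) (G H : multigraph V) (E : {set edge G})
    (F : {set edge H}) r u v :
  adj E =2 adj F -> tree_parent E r u v -> tree_parent F r u v.
Proof. by move=> eqEF [p [ep up lp]]; exists p; split; rewrite // -(eq_path eqEF). Qed.

Lemma Kn_joins_inj n (k l : edge (Kn n)) i j : joins k i j -> joins l i j -> k = l.
Proof.
case: k l => [[k1 k2] /= lk] [[l1 l2] /= ll] jk jl; apply: val_inj => /=.
have {}jk : (k1 == i) && (k2 == j) || (k1 == j) && (k2 == i) := jk.
have {}jl : (l1 == i) && (l2 == j) || (l1 == j) && (l2 == i) := jl.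
case/orP: jk lk => /andP[/eqP-> /eqP->]; case/orP: jl ll => /andP[/eqP-> /eqP->] //; lia.
Qed.

Section Bijection.
Variables (n : nat) (a b : int).
Local Notation K := (Kab n a b).
Implicit Types (e f : edge K) (T : {set edge K}) (h : 'I_n -> nat) (i j u v r : 'I_n).

Definition proj e : edge (Kn n) := exist _ (val e).1 (valP e).

(* The O_h-larger endpoint of e, for every h with which e is coherent. *)
Definition child e : 'I_n := if gain e <= 0 then tgt e else src e.

Definition gain_weight (g : int) : int := if g <= 0 then 1 - g else g.

(** Defined on all edge sets without choosing a height: the root is a vertex that is the child of no
    edge, and [r0] is a default when there is none. *)
Definition tree_of (r0 : 'I_n) T : weighted_rooted_graph n :=
  WeightedRootedGraph
    (odflt r0 [pick r | [forall e in T, child e != r]])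
    [ffun k => omap (fun e => gain_weight (gain e)) [pick e in T | proj e == k]].

Lemma proj_inj h : {in coherent_edges K h &, injective proj}.
Proof.
move=> e f; rewrite !inE => /eqP ge /eqP gf ef.
have se : src e = src f by rewrite -[src e]/(src (proj e)) ef.
have te : tgt e = tgt f by rewrite -[tgt e]/(tgt (proj e)) ef.
by apply: Kab_edge_eq; rewrite -?ge -?gf ?se ?te.
Qed.

Lemma adj_proj T : adj (proj @: T)%SET =2 adj T.
Proof. exact: adj_imset. Qed.

(** Gain at most 0 means that [tgt e] is no higher than [src e], and a tie is broken by the labels
    in favour of [src e]. *)
Lemma child_Oh h e u v : coherent h e -> joins e u v -> Oh h u v -> child e = v.
Proof.
move=> /eqP ge; rewrite /child -ge; have := Kab_src_lt_tgt e => lt je.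
by case/orP: je lt => /andP[/eqP-> /eqP->]; rewrite /Oh; case: ifP => //; lia.
Qed.

Lemma gain_weight_bounds h e u v : coherent h e -> joins e u v -> Oh h u v ->
  1 <= gain_weight (gain e) <= (if (u < v)%N then 1 - a else b).
Proof.
move=> coh je; have := gain_bounds e; rewrite (coherent_gap coh je).
by rewrite /gap /Oh /gain_weight; case: (ltnP u v) => ?; case: ifP; lia.
Qed.

(** A weight x arises from the two gains 1 - x and x; knowing which endpoint is O_h-smaller decides
    between them. *)
Lemma gain_weightK h e u v : coherent h e -> joins e u v -> Oh h u v ->
  gain e = if (u < v)%N then 1 - gain_weight (gain e) else gain_weight (gain e).
Proof.
move=> coh je; rewrite (coherent_gap coh je).
by rewrite /gap /Oh /gain_weight; case: (ltnP u v) => ?; case: ifP; lia.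
Qed.

Lemma edges_of_tree_of r0 T : edges_of (tree_of r0 T) = (proj @: T)%SET.
Proof.
apply/setP=> k; rewrite inE ffunE; case: pickP => [e /andP[eT /eqP <-]|none] /=.
  by rewrite imset_f.
by apply/esym/imsetP=> -[e eT ke]; have := none e; rewrite eT ke eqxx.
Qed.

Lemma weight_tree_of h r0 T e : T \subset coherent_edges K h -> e \in T ->
  weight (tree_of r0 T) (proj e) = Some (gain_weight (gain e)).
Proof.
move=> /fintype.subsetP coh eT; rewrite ffunE; case: pickP => [f /andP[fT /eqP fe]|/(_ e)].
  by rewrite (proj_inj (coh _ fT) (coh _ eT) fe).
by rewrite eT eqxx.
Qed.

(** Every vertex other than [r] has a parent, hence is the child of an edge, while [r] is the parent
    across each of its own edges. So [pick] can only return [r]. *)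
Lemma root_tree_of h r0 T r : T \subset coherent_edges K h ->
  (forall u v, connect (adj T) u v) ->
  (forall u v, tree_parent T r u v -> Oh h u v) -> Defs.root (tree_of r0 T) = r.
Proof.
move=> /fintype.subsetP coh conn par_lt /=; case: pickP => [r' /forallP r'P|] /=.
  apply/eqP/negPn/negP => /(tree_parent_exists conn)[u up].
  have /existsP[e /andP[eT je]] := tree_parent_adj up.
  have := r'P e; have := coh e eT; rewrite eT inE => ch.
  by rewrite (child_Oh ch je (par_lt _ _ up)) eqxx.
move/(_ r)/negP; case; apply/forallP=> e; apply/implyP=> eT.
have := coh e eT; rewrite inE => ch; apply/eqP => er.
have [|u je ur] := @incident_joins _ K e r.
  by rewrite -er /child; case: ifP; rewrite eqxx ?orbT.
have ru : adj T r u by apply/existsP; exists e; rewrite eT joinsC.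
have [p|/tree_parent_root//] := adj_tree_parent r conn ru.
have := child_Oh ch (etrans (joinsC _ _ _) je) (par_lt _ _ p).
by rewrite er => eru; rewrite eru eqxx in ur.
Qed.

(** A weight x prescribes a drop from parent to child of x - 1 towards a larger label and of x
    towards a smaller one. These are natural numbers because x is at least 1, so they can be summed
    along the tree. *)
Lemma tree_height_exists (t : weighted_rooted_graph n) : labelled_tree t (1 - a) b ->
  exists h, height_function h /\ forall u v k x, parent t u v -> joins k u v ->
    weight t k = Some x -> (h u)%:Z - (h v)%:Z = x - (u < v)%N%:Z.
Proof.
case=> /andP[/forallP conn /forallP acy] wP.
have {}conn u v : connect (adj (edges_of t)) u v by apply: (forallP (conn u)).
have {}acy (C : {set edge (Kn n)}) : C \subset edges_of t -> ~~ is_circle C.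
  exact: (implyP (acy C)).
have [c cP] : exists c : 'I_n -> nat, forall v u k x, parent t u v ->
    joins k u v -> weight t k = Some x -> (c v)%:Z = x - (u < v)%N%:Z.
  apply: (fin_all_exists (P := fun v cv => forall u k x, parent t u v ->
    joins k u v -> weight t k = Some x -> cv%:Z = x - (u < v)%N%:Z)) => v.
  (* The root has no parent, so its value 0 is arbitrary. *)
  have [->|vr] := eqVneq v (Defs.root t); first by exists 0%N => u k x /tree_parent_root.
  have [u up] := tree_parent_exists conn vr.
  have /existsP[k /andP[kE jk]] := tree_parent_adj up.
  move: kE; rewrite inE; case wk: (weight t k) => [x|] // _.
  exists `|x - (u < v)%N%:Z|%N => u' k' x' up' jk' wk'.
  have uu := tree_parent_unique acy up' up; subst u'.
  have kk := Kn_joins_inj jk jk'; subst k'.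
  move: wk'; rewrite wk => -[<-]; have := wP k u v x wk jk up.
  by case: (u < v)%N; lia.
have [d dP] := tree_potential (Defs.root t) conn acy c.
have dmax v : (d v <= \max_u d u)%N by apply: leq_bigmax.
(* Subtracting from the maximum turns depth below the root into height, with value 0 where [d] is
   maximal. *)
exists (fun v => \max_u d u - d v)%N; split.
  have [|v ->] := @bigop.eq_bigmax _ d; last by exists v; rewrite subnn.
  by apply/card_gt0P; exists (Defs.root t).
move=> u v k x up jk wk; have := dP u v up; have := cP v u k x up jk wk.
by have := dmax u; have := dmax v; lia.
Qed.

Hypothesis hsum : a + b = 0 \/ a + b = 1.

Lemma nbc_tree_height r0 T : is_nbc_tree T -> exists h,
  [/\ T \subset coherent_edges K h, spanning_tree T &
      forall u v, parent (tree_of r0 T) u v -> Oh h u v].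
Proof.
case=> span [h [[_ coh] nbc]]; exists h.
have cohT : T \subset coherent_edges K h.
  by apply/fintype.subsetP=> e /coh; rewrite inE.
split=> //; have uniqT := nbc_smaller_unique hsum cohT nbc.
(* From the O_h-least vertex, every simple path starts upwards in O_h, as [tree_parent_lt] requires;
   [root_tree_of] then identifies [r] with the chosen root. *)
have [r _ rmin] := @Oh_least n h predT r0 isT.
have par_lt : forall u v, tree_parent T r u v -> Oh h u v.
  apply: tree_parent_lt => // [v /adj_neq rv|u v /adj_neq]; last exact: Oh_total.
  by apply: rmin; rewrite // eq_sym.
have conn u v : connect (adj T) u v by have /andP[/forallP/(_ u)/forallP] := span.
move=> u v; rewrite /parent (root_tree_of r0 cohT conn par_lt) => par.
apply: par_lt; move: par; apply: eq_tree_parent => x y.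
by rewrite edges_of_tree_of adj_proj.
Qed.

Lemma tree_of_labelled r0 T : is_nbc_tree T -> labelled_tree (tree_of r0 T) (1 - a) b.
Proof.
case/(nbc_tree_height r0) => h [coh span par_lt]; split.
  rewrite edges_of_tree_of spanning_tree_imset //.
  move=> e f eT fT; apply: proj_inj; exact: (fintype.subsetP coh).
move=> k i j x wk jk /par_lt ij.
have : k \in edges_of (tree_of r0 T) by rewrite inE wk.
rewrite edges_of_tree_of => /imsetP[e eT ke]; move: wk.
rewrite ke (weight_tree_of _ coh eT) => -[<-].
have ch : coherent h e by have := fintype.subsetP coh _ eT; rewrite inE.
by apply: gain_weight_bounds ij; rewrite // -[joins e i j]/(joins (proj e) i j) -ke.
Qed.

(** Injectivity, one inclusion at a time. Edges of [T] and [T'] over the same edge of [Kn] share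
    their weight and, the rooted trees being equal, their parent endpoint; this fixes the gain
    without comparing [h] and [h']. *)
Lemma tree_of_subset r0 T T' : is_nbc_tree T -> is_nbc_tree T' ->
  tree_of r0 T = tree_of r0 T' -> T \subset T'.
Proof.
move=> nT nT' eqt; have [h [coh span par]] := nbc_tree_height r0 nT.
have [h' [coh' span' par']] := nbc_tree_height r0 nT'.
apply/fintype.subsetP=> e eT; have wk := weight_tree_of r0 coh eT.
have : proj e \in edges_of (tree_of r0 T') by rewrite -eqt inE wk.
rewrite edges_of_tree_of => /imsetP[f fT' ef].
have : weight (tree_of r0 T') (proj e) = Some (gain_weight (gain e)) by rewrite -eqt.
rewrite ef (weight_tree_of r0 coh' fT') => -[gw].
have ce : coherent h e by have := fintype.subsetP coh _ eT; rewrite inE.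
have cf : coherent h' f by have := fintype.subsetP coh' _ fT'; rewrite inE.
have sef : src e = src f by rewrite -[src e]/(src (proj e)) ef.
have tef : tgt e = tgt f by rewrite -[tgt e]/(tgt (proj e)) ef.
suff [u [v [je uv]]] : exists u v, joins e u v /\ parent (tree_of r0 T) u v.
  have jf : joins f u v by rewrite /joins -sef -tef.
  suff -> : e = f by [].
  apply: Kab_edge_eq => //; rewrite (gain_weightK ce je (par _ _ uv)).
  by rewrite (gain_weightK cf jf) ?gw //; apply: par'; rewrite -eqt.
have conn u v : connect (adj (edges_of (tree_of r0 T))) u v.
  rewrite edges_of_tree_of (eq_connect (adj_proj T)).
  by have /andP[/forallP/(_ u)/forallP] := span.
have je : joins e (src e) (tgt e) by rewrite /joins !eqxx.
have ae : adj (edges_of (tree_of r0 T)) (src e) (tgt e).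
  by rewrite edges_of_tree_of adj_proj; apply/existsP; exists e; rewrite eT.
have [p|p] := adj_tree_parent (Defs.root (tree_of r0 T)) conn ae.
  by exists (src e), (tgt e).
by exists (tgt e), (src e); rewrite joinsC.
Qed.

Lemma tree_of_surj r0 (t : weighted_rooted_graph n) : a <= b -> labelled_tree t (1 - a) b ->
  exists2 T, is_nbc_tree T & tree_of r0 T = t.
Proof.
move=> hab tP; have [h [hf hP]] := tree_height_exists tP.
have [span wP] := tP; have /andP[/forallP conn /forallP acy] := span.
have {}conn u v : connect (adj (edges_of t)) u v by apply: (forallP (conn u)).
have {}acy (C : {set edge (Kn n)}) : C \subset edges_of t -> ~~ is_circle C.
  exact: (implyP (acy C)).
(* The drop may vanish only when [u < v], and then the labels decide in favour of [u]. *)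
have par_lt u v : parent t u v -> Oh h u v.
  move=> up; have uv := tree_parent_adj up; have := adj_neq uv.
  case/existsP: uv => k /andP[]; rewrite inE; case wk: (weight t k) => [x|] // _ jk.
  have := wP k u v x wk jk up; have := hP u v k x up jk wk.
  by rewrite -val_eqE /Oh /=; case: ltngtP => //; lia.
(* The coherent lifts of the edges of [t]; [lift] below shows that each edge has one. *)
pose T := [set e : edge K | (proj e \in edges_of t) && coherent h e]%SET.
have cohT : T \subset coherent_edges K h.
  by apply/fintype.subsetP=> e; rewrite !inE => /andP[].
have lift k x : weight t k = Some x ->
    exists e, [/\ e \in T, proj e = k & gain_weight (gain e) = x].
  move=> wk; have kE : k \in edges_of t by rewrite inE wk.
  have lt : (src k < tgt k)%N by exact: (valP k).
  have jk : joins k (src k) (tgt k) by rewrite /joins !eqxx.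
  have jk' : joins k (tgt k) (src k) by rewrite joinsC.
  have ak : adj (edges_of t) (src k) (tgt k) by apply/existsP; exists k; rewrite kE.
  pose g := (h (tgt k))%:Z - (h (src k))%:Z.
  (* Here [g] is 1 - x or x according to which endpoint is the parent. The weight bounds give one
     side of the range, and [a <= 0 <= b] the other. *)
  have [gab gx] : a <= g <= b /\ gain_weight g = x.
    rewrite /g /gain_weight; have [p|p] := adj_tree_parent (Defs.root t) conn ak.
      have := wP _ _ _ _ wk jk p; have := hP _ _ _ _ p jk wk; rewrite lt.
      by case: hsum => ? ? ?; case: ifP; split; lia.
    have := wP _ _ _ _ wk jk' p; have := hP _ _ _ _ p jk' wk.
    rewrite ltnNge (ltnW lt) /=.
    by case: hsum => ? ? ?; case: ifP; split; lia.
  have [e [se te ge]] := Kab_edge_exists lt gab; exists e.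
  have pe : proj e = k.
    by apply: Kn_joins_inj jk; rewrite -se -te /joins !eqxx.
  by rewrite inE pe kE /coherent se te ge eqxx.
have projT : (proj @: T)%SET = edges_of t.
  apply/setP=> k; apply/imsetP/idP => [[e]|].
    by rewrite inE => /andP[eE _] ->.
  rewrite inE; case wk: (weight t k) => [x|] // _.
  by have [e [eT <- _]] := lift _ _ wk; exists e.
have adjT : adj (edges_of t) =2 adj T by move=> u v; rewrite -projT adj_proj.
exists T.
  split.
    rewrite -(@spanning_tree_imset _ _ _ proj) ?projT // => e f eT fT.
    by apply: proj_inj; apply: (fintype.subsetP cohT).
  exists h; split; first by split=> // e; rewrite inE => /andP[].
  move=> B; apply: smaller_unique_nbc; first exact: coherent_simple.
  (* Smaller neighbours are parents, so their uniqueness is that of parents. *)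
  have up u v : adj T u v -> Oh h u v -> parent t u v.
    rewrite -adjT => uv huv; have [//|/par_lt] := adj_tree_parent (Defs.root t) conn uv.
    by rewrite (Oh_asym huv).
  move=> u w v uv wv hu hw; exact: (tree_parent_unique acy (up _ _ uv hu) (up _ _ wv hw)).
have rT : Defs.root (tree_of r0 T) = Defs.root t.
  apply: root_tree_of cohT _ _ => [u v|u v p]; first by rewrite -(eq_connect adjT).
  by apply: par_lt; apply: eq_tree_parent p => x y; rewrite adjT.
have wT : weight (tree_of r0 T) = weight t.
  apply/ffunP=> k; case wk: (weight t k) => [x|].
    by have [e [eT <- <-]] := lift _ _ wk; apply: weight_tree_of cohT eT.
  have : k \notin edges_of (tree_of r0 T) by rewrite edges_of_tree_of projT inE wk.
  by rewrite inE; case: (weight _ k).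
by move: rT wT; case: (tree_of r0 T) => r w /=; case: (t) => r' w' /= -> ->.
Qed.

End Bijection.

Theorem theorem8 (n : nat) (a b : int)
  (hn : (1 <= n)%N) (hab : a <= b) (hsum : a + b = 0 \/ a + b = 1) :
  exists f : {set edge (Kab n a b)} -> weighted_rooted_graph n,
    set_bij (nbc_trees n a b) (rooted_labelled_trees n (1 - a) b) f.
Proof.
(* The first vertex, available since [n] is positive, serves as default root. *)
exists (tree_of (Ordinal hn)); split.
- by move=> T nT; apply: tree_of_labelled.
- move=> T T' /set_mem nT /set_mem nT' eqt; apply/eqP; rewrite finset.eqEsubset.
  by rewrite (tree_of_subset hsum nT nT' eqt) (tree_of_subset hsum nT' nT (esym eqt)).
- by move=> t /(tree_of_surj hsum (Ordinal hn) hab)[T nT <-]; exists T.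
Qed.
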